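(* For the path $P_n$ on $n\ge 1$ vertices, $$PRC(P_n)=\begin{cases}1 & \text{if } n=1,\\ 2 & \text{if } n=2,\\ 0 & \text{if } n=3,\\ 4 & \text{if } n\in\{4,6,8\},\\ 3 & \text{if } n=5,\\ 5 & \text{if } n\in\{7,9,10,11,13\},\\ 6 & \text{otherwise.}\end{cases}$$
   Context: All graphs are simple, finite and undirected. A set $S\subseteq V(G)$ is a dominating set if every vertex not in $S$ has a neighbor in $S$; $S$ is a perfect dominating set if every vertex in $V(G)\setminus S$ has exactly one neighbor in $S$. A perfect coalition in $G$ consists of two disjoint sets $V_1,V_2$ of vertices such that (i) neither $V_1$ nor $V_2$ is a dominating set of $G$; (ii) each vertex in $V(G)\setminus V_1$ has at most one neighbor in $V_1$, and each vertex in $V(G)\setminus V_2$ has at most one neighbor in $V_2$; (iii) $V_1\cup V_2$ is a perfect dominating set of $G$. A perfect coalition partition ($prc$-partition) of $G$ is a vertex partition $\pi=\{V_1,\dots,V_k\}$ such that each $V_i$ either is a singleton dominating set or forms a perfect coalition with some $V_j\in\pi$. $PRC(G)$ is the maximum cardinality of a $prc$-partition of $G$, with $PRC(G)=0$ if $G$ has no $prc$-partition. $P_n$ denotes the path on $n$ vertices. *)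

(* Defs.v *)
From HB Require Import structures.
From mathcomp Require Import all_boot.

Set Implicit Arguments.
Unset Strict Implicit.
Unset Printing Implicit Defensive.

Record sgraph := SGraph {
  vertex :> finType;
  adj : rel vertex;
  adj_sym : symmetric adj;
  adj_irrefl : irreflexive adj
}.

Section PerfectCoalitions.
Variable G : sgraph.
Implicit Types (v : G) (S A B : {set G}) (P : {set {set G}}).

Definition neighbors_in v S : {set G} := [set u in S | adj v u].

Definition dominating S : bool :=
  [forall (v | v \notin S), 0 < #|neighbors_in v S|].

Definition perfect_dominating S : bool :=
  [forall (v | v \notin S), #|neighbors_in v S| == 1].

Definition at_most_one_outside S : bool :=
  [forall (v | v \notin S), #|neighbors_in v S| <= 1].

Definition perfect_coalition A B : bool :=
  [&& [disjoint A & B],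
      ~~ dominating A && ~~ dominating B,
      at_most_one_outside A && at_most_one_outside B
    & perfect_dominating (A :|: B)].

Definition singleton_dominating A : bool := (#|A| == 1) && dominating A.

(* [partition] requires the blocks to be nonempty, so the [B] below, being
   disjoint from [A], is automatically a block different from [A]. *)
Definition prc_partition P : bool :=
  partition P [set: G] &&
  [forall A in P, singleton_dominating A ||
                  [exists B in P, perfect_coalition A B]].

End PerfectCoalitions.

(* An empty [\max] is 0, the value of PRC when there is no prc-partition. *)
Definition PRC (G : sgraph) : nat :=
  \max_(P : {set {set G}} | prc_partition P) #|P|.

Definition path_adj (n : nat) : rel 'I_n :=
  fun i j => (i.+1 == j :> nat) || (j.+1 == i :> nat).

Lemma path_adj_sym n : symmetric (@path_adj n).
Proof. by move=> i j; rewrite /path_adj orbC. Qed.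

Lemma path_adj_irrefl n : irreflexive (@path_adj n).
Proof. by move=> i; rewrite /path_adj orbb gtn_eqF. Qed.

Definition path_graph (n : nat) : sgraph :=
  SGraph (@path_adj_sym n) (@path_adj_irrefl n).

(* Main.v *)
Require Import Defs.
From mathcomp Require Import all_boot zify.

(* For [n > 3] no vertex of the path dominates it, so every block has a partner.
   The blocks meeting a closed neighbourhood cover all the edges of the
   coalition graph.  An end vertex gives such a cover of size 2, and a vertex
   not dominated by a block gives a cover of size at most 3 avoiding this block;
   together they bound the number of blocks by 6.
   Encoding a partition as a word of colours makes all the conditions properties
   of the windows of three consecutive letters.  The remaining upper bounds
   follow from a search over the words numbering colours by first occurrence;
   the value 6 is attained for [n = 12] and [n > 13] by prefixing copies of 0110
   to words of lengths 12, 14, 15 and 17. *)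

Set Implicit Arguments.
Unset Strict Implicit.
Unset Printing Implicit Defensive.


(** * Symmetric relations with small vertex covers *)

Section CoveredRelation.
Variables (T : finType) (P : {set T}) (e : rel T).

Definition covers (C : {set T}) :=
  forall x y, x \in P -> y \in P -> e x y -> (x \in C) || (y \in C).

Hypothesis e_sym : {in P &, symmetric e}.
Hypothesis e_total : forall x, x \in P -> exists2 y, y \in P & e x y.
Hypothesis avoiding_cover :
  forall x, x \in P -> exists C, [/\ covers C, #|C| <= 3 & x \notin C].

Let nb (x : T) := [set y in P | e x y].

Lemma nb_sub_cover x C : x \in P -> covers C -> x \notin C -> nb x \subset C.
Proof.
move=> xP coverC xC; apply/subsetP => y; rewrite inE => /andP[yP exy].
by have := coverC x y xP yP exy; rewrite (negbTE xC).
Qed.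

(** A cover avoiding [a] contains all neighbours of [a]. If three of them differ from [b], they
    already exhaust this cover, which therefore avoids [b] too and contains the neighbours of
    [b]. *)
Lemma card_leaves a b : a \in P -> b \in P -> 2 < #|nb a :\ b| ->
  #|nb a :\ b :|: nb b :\ a| <= 3.
Proof.
move=> aP bP big_a; have [C [coverC leC aC]] := avoiding_cover aP.
have subC : nb a :\ b \subset C.
  exact: subset_trans (subsetDl _ _) (nb_sub_cover aP coverC aC).
have eqC : nb a :\ b = C.
  by apply/eqP; rewrite eqEcard subC (leq_trans leC).
have bC : b \notin C by rewrite -eqC !inE eqxx.
have /setUidPl -> : nb b :\ a \subset nb a :\ b.
  by rewrite eqC (subset_trans (subsetDl _ _)) // nb_sub_cover.
by rewrite eqC.
Qed.

(** Everything outside [C0] is related to an element of [C0]. One centre has at most three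
    neighbours; two centres have at most four leaves together, either two each or, by [card_leaves],
    three in all. *)
Lemma card_covered_le6 (C0 : {set T}) : C0 \subset P -> covers C0 -> #|C0| <= 2 -> #|P| <= 6.
Proof.
move=> sub0 cover0 le2.
have nb_le3 x : x \in P -> #|nb x| <= 3.
  move=> xP; have [C [coverC leC xC]] := avoiding_cover xP.
  exact: leq_trans (subset_leq_card (nb_sub_cover xP coverC xC)) leC.
have subP : P \subset C0 :|: \bigcup_(x in C0) (nb x :\: C0).
  apply/subsetP => y yP; rewrite inE.
  case yC: (y \in C0) => //=; have [x xP eyx] := e_total yP.
  have xC : x \in C0 by have := cover0 y x yP xP eyx; rewrite yC.
  by apply/bigcupP; exists x; rewrite // !inE yC yP e_sym.
apply: leq_trans (subset_leq_card subP) _.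
case: (ltngtP #|C0| 2) le2 => // [lt2 _|/eqP eq2 _].
  apply: leq_trans (leq_card_setU _ _) _.
  have [/eqP|C0n0] := posnP #|C0|.
    by rewrite cards_eq0 => /eqP ->; rewrite big_set0 cards0.
  have /cards1P[a C0a] : #|C0| == 1 by rewrite eqn_leq -ltnS lt2.
  rewrite C0a big_set1 cards1 (@leq_add 1 _ 1 5) //.
  have aP : a \in P by apply: (subsetP sub0); rewrite C0a set11.
  exact: leq_trans (subset_leq_card (subsetDl _ _)) (leq_trans (nb_le3 a aP) _).
have /cards2P[a [b [neq_ab C0ab]]] := eq2.
have aP : a \in P by apply: (subsetP sub0); rewrite C0ab !inE eqxx.
have bP : b \in P by apply: (subsetP sub0); rewrite C0ab !inE eqxx orbT.
have sub : \bigcup_(x in C0) (nb x :\: C0) \subset nb a :\ b :|: nb b :\ a.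
  apply/bigcupsP => x; rewrite C0ab !inE => /orP[] /eqP ->;
    apply/subsetP => y; rewrite !inE negb_or => /andP[/andP[-> ->] ->] //.
  by rewrite orbT.
apply: leq_trans (leq_card_setU _ _) _.
rewrite (eqP eq2) (@leq_add 2 _ 2 4) // (leq_trans (subset_leq_card sub)) //.
have [le_a|gt_a] := leqP #|nb a :\ b| 2; last first.
  exact: leqW (card_leaves aP bP gt_a).
have [le_b|gt_b] := leqP #|nb b :\ a| 2; last first.
  by rewrite setUC; apply/leqW/card_leaves.
exact: leq_trans (leq_card_setU _ _) (leq_add le_a le_b).
Qed.

End CoveredRelation.

(** * Perfect coalitions in an arbitrary graph *)

Section GraphCoalitions.
Variable G : sgraph.
Implicit Types (u v : G) (A B : {set G}) (P : {set {set G}}).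

Definition closed_nbhd v : {set G} := v |: [set u | adj v u].

Lemma perfect_dominatingW A : perfect_dominating A -> dominating A.
Proof.
move=> /forallP pdA; apply/forallP => v; apply/implyP => vA.
by have := pdA v; rewrite vA => /eqP ->.
Qed.

Lemma dominatingP A :
  reflect (forall v, exists2 u, u \in A & u \in closed_nbhd v) (dominating A).
Proof.
apply: (iffP forallP) => domA v.
  have [vA|vA] := boolP (v \in A); first by exists v; rewrite // !inE eqxx.
  have := domA v; rewrite vA /= => /card_gt0P[u]; rewrite inE => /andP[uA uv].
  by exists u; rewrite // !inE uv orbT.
apply/implyP => vA; have [u uA] := domA v.
rewrite !inE => /orP[/eqP uv|uv]; first by rewrite -uv uA in vA.
by apply/card_gt0P; exists u; rewrite inE uA.
Qed.

Lemma perfect_coalition_sym A B : perfect_coalition A B = perfect_coalition B A.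
Proof.
by rewrite /perfect_coalition disjoint_sym setUC
  (andbC (~~ dominating A)) (andbC (at_most_one_outside A)).
Qed.

Lemma PRC_eq k :
    (forall P, prc_partition P -> #|P| <= k) ->
    (exists2 P : {set {set G}}, prc_partition P & #|P| = k) ->
  PRC G = k.
Proof.
move=> ub [P prcP cardP]; apply/eqP; rewrite eqn_leq; apply/andP; split.
  exact/bigmax_leqP.
by rewrite -cardP; apply: leq_bigmax_cond.
Qed.

(* A coalition not containing [u] would meet [N(u)], hence all of [G], in a
   single vertex, so one of its two members would be empty and the other one
   dominating. *)
Lemma no_perfect_coalition u A B :
  dominating [set u] -> ~~ perfect_coalition A B.
Proof.
move=> /dominatingP domu; apply/negP => /and4P[dAB /andP[nA nB] _ pdAB].
have univ v : v = u \/ adj u v.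
  have [w] := domu v; rewrite inE => /eqP ->; rewrite !inE.
  by rewrite adj_sym => /orP[/eqP|]; [left|right].
have notin C : ~~ dominating C -> u \notin C.
  apply: contra => uC; apply/dominatingP => v; have [w] := domu v.
  by rewrite inE => /eqP ->; exists u.
have uAB : u \notin A :|: B by rewrite inE negb_or !notin.
have := forallP pdAB u; rewrite uAB /=.
have -> : neighbors_in u (A :|: B) = A :|: B.
  apply/setP => v; rewrite inE; case vAB: (v \in A :|: B) => //=.
  by have [vu|//] := univ v; rewrite -vu vAB in uAB.
rewrite cardsU (disjoint_setI0 dAB) cards0 subn0.
have dAB' := perfect_dominatingW pdAB.
have gt0 (C D : {set G}) : dominating (C :|: D) -> ~~ dominating D -> 0 < #|C|.
  move=> domCD; rewrite lt0n cards_eq0; apply: contra => /eqP C0.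
  by rewrite C0 set0U in domCD.
have gtA := gt0 A B dAB' nB.
have gtB : 0 < #|B| by apply: (gt0 B A) => //; rewrite setUC.
by move: (leq_add gtA gtB) => + /eqP eq1; rewrite eq1.
Qed.

Lemma card_partition_le P : partition P [set: G] -> #|P| <= #|G|.
Proof.
move=> partP; have /and3P[_ _ n0] := partP.
rewrite -cardsT (card_partition partP) -sum1_card.
apply: leq_sum => A AP; rewrite lt0n cards_eq0.
by apply: contraNneq n0 => <-.
Qed.

Lemma PRC_complete : (forall u v, u != v -> adj u v) -> PRC G = #|G|.
Proof.
move=> complG; apply: PRC_eq => [P /andP[] /card_partition_le //|].
exists [set [set v] | v : G]; last by rewrite card_imset //; exact: set1_inj.
apply/andP; split.
  apply/and3P; split.
  - apply/eqP/setP => v; rewrite inE; apply/bigcupP.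
    by exists [set v]; rewrite ?set11 // imset_f.
  - apply/trivIsetP => _ _ /imsetP[u _ ->] /imsetP[v _ ->] uv.
    by rewrite disjoints1 inE; apply: contraNneq uv => ->.
  - apply/imsetP => -[v _ /setP/(_ v)]; rewrite !inE eqxx //.
apply/forallP => A; apply/implyP => /imsetP[v _ ->].
rewrite /singleton_dominating cards1 /=; apply/orP; left.
apply/dominatingP => u; exists v; rewrite ?inE //.
by have [//|] := eqVneq v u; rewrite eq_sym /=; apply: complG.
Qed.

(** A universal vertex excludes all coalitions, so every block would be a dominating singleton; the
    block of [w] fails to dominate [v]. *)
Lemma PRC_universal_vertex u v w :
  dominating [set u] -> v != w -> ~~ adj v w -> PRC G = 0.
Proof.
move=> domu vw nvw; rewrite /PRC big_pred0 // => P; apply/negbTE/negP.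
case/andP=> partP /forallP/(_ (pblock P w)).
have wP : w \in cover P by rewrite (cover_partition partP) inE.
rewrite pblock_mem //= => /orP[|/existsP[B /andP[_]]]; last first.
  by apply/negP; apply: no_perfect_coalition domu.
case/andP=> /cards1P[x blk] domx; have := mem_pblock P w.
rewrite wP blk inE => /eqP wx; move: domx; rewrite blk -wx.
move=> /dominatingP/(_ v)[y]; rewrite inE => /eqP ->.
by rewrite !inE eq_sym (negbTE vw) (negbTE nvw).
Qed.

Definition blocks_near P v := [set pblock P u | u in closed_nbhd v].

Lemma blocks_near_sub P v : partition P [set: G] -> blocks_near P v \subset P.
Proof.
move=> partP; apply/subsetP => _ /imsetP[u _ ->].
by rewrite pblock_mem // (cover_partition partP) inE.
Qed.

Lemma mem_blocks_near P A u v : partition P [set: G] ->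
  A \in P -> u \in A -> u \in closed_nbhd v -> A \in blocks_near P v.
Proof.
move=> /and3P[_ tP _] AP uA uv; apply/imsetP; exists u => //.
by rewrite (def_pblock tP AP uA).
Qed.

(** The union of a coalition dominates [v], so one of its two members meets the closed neighbourhood
    of [v]. *)
Lemma blocks_near_covers P v :
  partition P [set: G] -> covers P (@perfect_coalition G) (blocks_near P v).
Proof.
move=> partP A B AP BP /and4P[_ _ _ /perfect_dominatingW/dominatingP/(_ v)].
case=> u; rewrite inE => /orP[] uX uv.
  by rewrite (mem_blocks_near partP AP uX uv).
by rewrite (mem_blocks_near partP BP uX uv) orbT.
Qed.

Lemma prc_partition_le6 P v :
    (forall u, #|closed_nbhd u| <= 3) -> #|closed_nbhd v| <= 2 ->
    (forall u, ~~ dominating [set u]) -> prc_partition P ->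
  #|P| <= 6.
Proof.
move=> le3 le2 nodom /andP[partP /forallP prcP].
have partner A : A \in P -> exists2 B, B \in P & perfect_coalition A B.
  move=> AP; have := prcP A; rewrite AP /= => /orP[/andP[/cards1P[u ->]]|].
    by rewrite (negbTE (nodom u)).
  by case/existsP=> B /andP[BP AB]; exists B.
apply: (@card_covered_le6 _ P (@perfect_coalition G) _ partner _
  (blocks_near P v)).
- by move=> A B _ _; exact: perfect_coalition_sym.
(* Having a partner, [A] is not dominating; the blocks near a vertex [u] that it misses form the
   cover avoiding [A]. *)
- move=> A AP; have [B _ /and4P[_ /andP[ndA _] _ _]] := partner A AP.
  move: ndA; rewrite negb_forall => /existsP[u].
  rewrite negb_imply => /andP[uA nuA].
  exists (blocks_near P u); split; first exact: blocks_near_covers.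
    exact: leq_trans (leq_imset_card _ _) (le3 u).
  apply: contra nuA => /imsetP[w wu Aw]; have wA : w \in A.
    by rewrite Aw mem_pblock (cover_partition partP) inE.
  move: wu; rewrite !inE => /orP[/eqP wu|uw]; first by rewrite -wu wA in uA.
  by apply/card_gt0P; exists w; rewrite inE wA.
- exact: blocks_near_sub.
- exact: blocks_near_covers.
- exact: leq_trans (leq_imset_card _ _) le2.
Qed.

End GraphCoalitions.


(** * Paths as words of colours *)

(* A window lists the colours of a vertex's left neighbour, of the vertex, and
   of its right neighbour; the colour [k], which no vertex has, stands for a
   missing neighbour. *)
Definition window := (nat * nat * nat)%type.
Implicit Types (t : window) (S : pred nat) (w : seq nat) (W : seq window).

Fixpoint windows k x w : seq window :=
  if w is y :: w' then (x, y, head k w') :: windows k y w' else [::].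

Definition dominates_at S t := [|| S t.1.2, S t.1.1 | S t.2].
Definition at_most_one_at S t := S t.1.2 || ~~ (S t.1.1 && S t.2).
Definition perfect_at S t := S t.1.2 || (S t.1.1 (+) S t.2).

(** These are the conditions required at every vertex. Non-domination only has to be witnessed at
    one vertex, so it is kept apart. *)
Definition coalition_at i j t :=
  [&& at_most_one_at (pred1 i) t, at_most_one_at (pred1 j) t
    & perfect_at (pred2 i j) t].

Definition word_coalition i j W :=
  [&& i != j, ~~ all (dominates_at (pred1 i)) W,
      ~~ all (dominates_at (pred1 j)) W & all (coalition_at i j) W].

Definition word_prc k W :=
  all (fun i => has (fun j => word_coalition i j W) (iota 0 k)) (iota 0 k).

Lemma size_windows k x w : size (windows k x w) = size w.
Proof. by elim: w x => //= y w IHw x; rewrite IHw. Qed.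

Lemma nth_windows k x w t0 i : i < size w ->
  nth t0 (windows k x w) i = (nth k (x :: w) i, nth k w i, nth k w i.+1).
Proof.
elim: w x i => //= y w IHw x [_|i]; first by rewrite nth0.
exact: IHw.
Qed.

Section ColouredPath.
Variables (n k : nat) (w : seq nat).
Hypothesis size_w : size w = n.
Let G := path_graph n.

Definition colour_class S : {set G} := [set v : 'I_n | S (nth k w v)].

(** The left neighbour is read in [k :: w] and the right one in [w] with default [k]; since [S]
    rejects [k], missing neighbours count as 0. *)
Lemma card_neighbors_in (v : G) S : ~~ S k ->
  #|neighbors_in v (colour_class S)| =
    S (nth k (k :: w) (v : 'I_n)) + S (nth k w (v : 'I_n).+1).
Proof.
move=> Sk.
have count1 j : \sum_(u < n) (S (nth k w u) && (u == j :> nat)) = S (nth k w j).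
  have [lt_j|le_j] := ltnP j n.
    rewrite (bigD1 (Ordinal lt_j)) //= eqxx andbT big1 ?addn0 // => u.
    by rewrite -val_eqE /= => /negbTE ->; rewrite andbF.
  rewrite big1 => [|u _]; last first.
    by rewrite (ltn_eqF (leq_trans (ltn_ord u) le_j)) andbF.
  by rewrite nth_default ?size_w // (negbTE Sk).
have -> : S (nth k (k :: w) (v : 'I_n)) =
    \sum_(u < n) (S (nth k w u) && (u.+1 == (v : 'I_n) :> nat)) :> nat.
  case: {+}(v : 'I_n) => [[|m] lt_m] /=; last by rewrite -count1.
  by rewrite (negbTE Sk) big1 // => u _; rewrite andbF.
rewrite -count1 -big_split /= -sum1_card big_mkcond /=.
apply: eq_bigr => u _; rewrite !inE /= /path_adj eq_sym.
case: (S _) => //=; rewrite ![_ == (v : 'I_n).+1]eq_sym.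
(* No [u] is both left and right neighbour of [v], so the disjunction counts as a sum. *)
by case: (eqVneq v.+1 _) => [<-|_]; case: eqP => //= /eqP;
  rewrite ?gtn_eqF // ltnS leqnSn.
Qed.

Lemma all_windowsP (Q : pred window) :
  reflect (forall v : 'I_n,
             Q (nth k (k :: w) v, nth k w v, nth k w v.+1))
          (all Q (windows k k w)).
Proof.
apply: (iffP (all_nthP (k, k, k))) => allQ => [v | i].
  by have := allQ v; rewrite size_windows size_w nth_windows ?size_w //; apply.
rewrite size_windows size_w => lt_i.
by rewrite nth_windows ?size_w //; exact: (allQ (Ordinal lt_i)).
Qed.

Lemma dominating_class S : ~~ S k ->
  dominating (colour_class S) = all (dominates_at S) (windows k k w).
Proof.
move=> Sk; apply/forallP/all_windowsP => allS v; have := allS v;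
  rewrite card_neighbors_in // inE /dominates_at /=;
  by do 3!case: (S _).
Qed.

Lemma at_most_one_class S : ~~ S k ->
  at_most_one_outside (colour_class S) = all (at_most_one_at S) (windows k k w).
Proof.
move=> Sk; apply/forallP/all_windowsP => allS v; have := allS v;
  rewrite card_neighbors_in // inE /at_most_one_at /=;
  by do 3!case: (S _).
Qed.

Lemma perfect_class S : ~~ S k ->
  perfect_dominating (colour_class S) = all (perfect_at S) (windows k k w).
Proof.
move=> Sk; apply/forallP/all_windowsP => allS v; have := allS v;
  rewrite card_neighbors_in // inE /perfect_at /=;
  by do 3!case: (S _).
Qed.

(** As [i] occurs in [w], its class is nonempty, which makes disjointness of the two classes
    equivalent to [i != j]. *)
Lemma perfect_coalition_class i j : i < k -> j < k -> i \in w ->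
  perfect_coalition (colour_class (pred1 i)) (colour_class (pred1 j)) =
    word_coalition i j (windows k k w).
Proof.
move=> lt_i lt_j iw.
have ik : ~~ pred1 i k by rewrite /= gtn_eqF.
have jk : ~~ pred1 j k by rewrite /= gtn_eqF.
have ijk : ~~ pred2 i j k by rewrite /= negb_or !gtn_eqF.
rewrite /perfect_coalition /word_coalition -!dominating_class //.
have -> : [disjoint colour_class (pred1 i) & colour_class (pred1 j)] = (i != j).
  apply/idP/idP; last first.
    move=> neq_ij; rewrite disjoint_subset; apply/subsetP => v.
    by rewrite !inE => /eqP ->.
  apply: contraTneq => <-; rewrite -setI_eq0 setIid.
  have lt_v : index i w < n by rewrite -size_w index_mem.
  by apply/set0Pn; exists (Ordinal lt_v); rewrite inE /= nth_index.
have -> : colour_class (pred1 i) :|: colour_class (pred1 j) =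
    colour_class (pred2 i j) by apply/setP => v; rewrite !inE.
rewrite !at_most_one_class // perfect_class //.
by rewrite !all_predI -!andbA.
Qed.

Lemma prc_partition_of_word :
    all (fun c => c < k) w -> all (mem w) (iota 0 k) ->
    word_prc k (windows k k w) ->
  exists2 P : {set {set G}}, prc_partition P & #|P| = k.
Proof.
move=> /allP w_lt /allP w_onto /allP prc_w.
have onto (i : 'I_k) : (i : nat) \in w.
  by apply: w_onto; rewrite mem_iota ltn_ord.
pose cls (i : 'I_k) := colour_class (pred1 (i : nat)).
have wit (i : 'I_k) : exists v : 'I_n, nth k w v = i.
  have lt_v : index (i : nat) w < n by rewrite -size_w index_mem.
  by exists (Ordinal lt_v); rewrite /= nth_index.
have cls_inj : injective cls.
  move=> i j /setP eq_ij; have [v vi] := wit i; have := eq_ij v.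
  by rewrite !inE vi eqxx => /esym/eqP/val_inj.
exists [set cls i | i : 'I_k]; last by rewrite card_imset // card_ord.
apply/andP; split.
  apply/and3P; split.
  - apply/eqP/setP => v; rewrite inE; apply/bigcupP.
    have lt_v : nth k w v < k by apply: w_lt; rewrite mem_nth // size_w.
    by exists (cls (Ordinal lt_v)); rewrite ?imset_f // inE /=.
  - apply/trivIsetP => _ _ /imsetP[i _ ->] /imsetP[j _ ->] neq_ij.
    rewrite disjoint_subset; apply/subsetP => v; rewrite !inE => /eqP ->.
    by apply: contraNneq neq_ij => /val_inj ->.
  - apply/imsetP => -[i _ /setP eq0]; have [v vi] := wit i.
    by have := eq0 v; rewrite !inE vi eqxx.
apply/forallP => A; apply/implyP => /imsetP[i _ ->]; apply/orP; right.
have := prc_w i; rewrite mem_iota ltn_ord => /(_ isT)/hasP[j].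
rewrite mem_iota /= add0n => lt_j coal_ij; apply/existsP; exists (cls (Ordinal lt_j)).
by rewrite imset_f //= perfect_coalition_class.
Qed.

End ColouredPath.

(** * Numbering colours by first occurrence *)

Section FirstOccurrence.
Variable T : eqType.
Implicit Types (s u : seq T).

Fixpoint first_occs u s :=
  if s is x :: s' then first_occs (if x \in u then u else rcons u x) s' else u.

Fixpoint canonical m w :=
  if w is c :: w' then (c <= m) && canonical (maxn m c.+1) w' else true.

Lemma first_occs_uniq u s : uniq u -> uniq (first_occs u s).
Proof.
elim: s u => //= x s IHs u uniq_u; apply: IHs.
by case: ifPn => // xu; rewrite rcons_uniq xu.
Qed.

Lemma mem_first_occs u s : first_occs u s =i u ++ s.
Proof.
elim: s u => [|x s IHs] u y /=; first by rewrite cats0.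
rewrite IHs !mem_cat inE; case: ifPn => xu; last first.
  by rewrite mem_rcons inE orbCA orbA.
by case: eqP => [->|]; rewrite ?xu.
Qed.

Lemma index_first_occs u s x : x \in u -> index x (first_occs u s) = index x u.
Proof.
elim: s u => //= y s IHs u xu; case: ifPn => yu; first exact: IHs.
by rewrite IHs ?mem_rcons ?inE ?xu ?orbT // -cats1 index_cat xu.
Qed.

(** A known element keeps its index below [size u]; a new one is appended and receives exactly the
    index [size u]. *)
Lemma canonical_first_occs u s :
  canonical (size u) [seq index x (first_occs u s) | x <- s].
Proof.
elim: s u => //= x s IHs u; case: ifPn => xu.
  rewrite index_first_occs // index_size /=.
  by move: (xu); rewrite -index_mem => /maxn_idPl ->.
have ind : index x (rcons u x) = size u.
  by rewrite -cats1 index_cat (negbTE xu) /= eqxx addn0.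
rewrite index_first_occs ?mem_rcons ?inE ?eqxx // ind leqnn /=.
rewrite (maxn_idPr (leqnSn _)).
by rewrite -(size_rcons u x).
Qed.

End FirstOccurrence.

Lemma word_of_prc_partition n k (P : {set {set path_graph n}}) :
    (forall v : path_graph n, ~~ dominating [set v]) ->
    prc_partition P -> #|P| = k ->
  exists w, [/\ size w = n, all (fun c => c < k) w, canonical 0 w
              & word_prc k (windows k k w)].
Proof.
move=> nodom /andP[partP /forallP prcP] cardP.
pose blk := pblock P; pose s := [seq blk v | v <- enum 'I_n].
pose U := first_occs [::] s.
have blkP v : blk v \in P by rewrite pblock_mem // (cover_partition partP) inE.
have memU A : (A \in U) = (A \in P).
  rewrite mem_first_occs /=; apply/mapP/idP => [[v _ ->]|AP]; first exact: blkP.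
  have /set0Pn[v vA] : A != set0.
    by have /and3P[_ _ n0] := partP; apply: contraNneq n0 => <-.
  exists v; rewrite ?mem_enum //.
  by have /and3P[_ tP _] := partP; rewrite /blk (def_pblock tP AP vA).
have sizeU : size U = k.
  rewrite -cardP -(card_uniqP (first_occs_uniq s (isT : uniq [::]))).
  exact: eq_card.
pose w := [seq index A U | A <- s].
have sizes : size s = n by rewrite size_map size_enum_ord.
have sizew : size w = n by rewrite size_map.
have nth_w (v : 'I_n) : nth k w v = index (blk v) U.
  rewrite (nth_map set0) ?sizes //.
  by rewrite (nth_map v) ?size_enum_ord // nth_ord_enum.
have cls A : A \in P -> A = colour_class n k w (pred1 (index A U)).
  move=> AP; apply/setP => v; rewrite inE /= nth_w.
  rewrite (inj_in_eq (@index_inj _ set0 U)) ?memU //.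
  have /and3P[_ tP _] := partP.
  apply/idP/eqP => [vA|<-]; first exact: def_pblock.
  by rewrite mem_pblock (cover_partition partP) inE.
exists w; split=> //.
- by apply/allP => _ /mapP[A /mapP[v _ ->] ->]; rewrite -sizeU index_mem memU.
- exact: (canonical_first_occs [::]).
- apply/allP => i; rewrite mem_iota /= add0n => lt_i.
  pose A := nth set0 U i; have AP : A \in P by rewrite -memU mem_nth // sizeU.
  have iA : index A U = i by rewrite index_uniq ?sizeU ?first_occs_uniq.
  have := prcP A; rewrite AP /= => /orP[/andP[/cards1P[v ->]]|].
    by rewrite (negbTE (nodom v)).
  case/existsP=> B /andP[BP AB]; apply/hasP; exists (index B U).
    by rewrite mem_iota /= add0n -sizeU index_mem memU.
  have ltB : index B U < k by rewrite -sizeU index_mem memU.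
  rewrite -iA -(@perfect_coalition_class n) -?cls ?iA //.
  (* A vertex of the nonempty block [A] shows that its number occurs in [w]. *)
  have /set0Pn[v vA] : A != set0.
    by have /and3P[_ _ n0] := partP; apply: contraNneq n0 => <-.
  by move: vA; rewrite (cls A AP) inE /= iA => /eqP <-; rewrite mem_nth // sizew.
Qed.


(** * The search for words and its correctness *)

(* Depth-first search for canonical words: [y] is the current letter and [x]
   the previous one, [m] colours are in use, [vs] lists the pairs of colours
   which may still form a coalition, and [ds] the colours which have dominated
   every vertex so far. *)
Fixpoint search k r x y m (vs : seq (nat * nat)) (ds : seq nat) : bool :=
  let next z := [seq p <- vs | coalition_at p.1 p.2 (x, y, z)] in
  let dom z := [seq i <- ds | dominates_at (pred1 i) (x, y, z)] in
  if r is r'.+1 then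
    has (fun z => all (fun i => has (fun p => p.1 == i) (next z)) (iota 0 k) &&
                  search k r' y z (maxn m z.+1) (next z) (dom z))
        (iota 0 (minn k m.+1))
  else
    all (fun i => has (fun p => [&& p.1 == i, p.1 \notin dom k
                                  & p.2 \notin dom k]) (next k)) (iota 0 k).

(** A canonical word starts with 0, so one colour is in use and [n.-1] letters remain. Pairs are
    ordered, so that each colour looks for its partner as the first component. *)
Definition search_from_start k n :=
  search k n.-1 k 0 1 [seq p <- allpairs pair (iota 0 k) (iota 0 k) | p.1 != p.2]
    (iota 0 k).

(** The search invariant, with [W] the windows still to be read: some surviving pair suits [i] to
    the end, and each of its members has missed a vertex already or will miss one in [W]. *)
Definition viable (vs : seq (nat * nat)) (ds : seq nat) (W : seq window) i :=
  exists p : nat * nat,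
    [/\ p \in vs, p.1 = i, all (coalition_at p.1 p.2) W,
        ~~ ((p.1 \in ds) && all (dominates_at (pred1 p.1)) W)
      & ~~ ((p.2 \in ds) && all (dominates_at (pred1 p.2)) W)].

Lemma viable_cons vs ds t W i :
    viable vs ds (t :: W) i ->
  viable [seq p <- vs | coalition_at p.1 p.2 t]
    [seq i <- ds | dominates_at (pred1 i) t] W i.
Proof.
move=> [p [pvs pi /= /andP[pt pW] nd1 nd2]]; exists p; split=> //.
- by rewrite mem_filter pt.
- by rewrite mem_filter (andbC _ (p.1 \in ds)) -andbA.
- by rewrite mem_filter (andbC _ (p.2 \in ds)) -andbA.
Qed.

(** Following the letters of [w] itself, the invariant guarantees that no branch is pruned. Hence a
    failed search excludes all words. *)
Lemma searchP k x y m vs ds w :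
    all (fun c => c < k) w -> canonical m w ->
    (forall i, i < k -> viable vs ds (windows k x (y :: w)) i) ->
  search k (size w) x y m vs ds.
Proof.
elim: w x y m vs ds => [|z w IHw] x y m vs ds /=.
  move=> _ _ via; apply/allP => i; rewrite mem_iota /= => lt_i.
  have [p [pvs pi _ nd1 nd2]] := viable_cons (via i lt_i).
  by apply/hasP; exists p; rewrite // pi eqxx -{1}pi; move: nd1 nd2; rewrite /= !andbT => -> ->.
case/andP=> lt_z w_lt /andP[le_z can_w] via.
have via' i : i < k -> viable [seq p <- vs | coalition_at p.1 p.2 (x, y, z)]
    [seq i <- ds | dominates_at (pred1 i) (x, y, z)] (windows k y (z :: w)) i.
  by move=> lt_i; exact: viable_cons (via i lt_i).
apply/hasP; exists z; first by rewrite mem_iota /= add0n leq_min lt_z.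
apply/andP; split; last exact: IHw.
apply/allP => i; rewrite mem_iota /= => /via'[p [pvs pi _ _ _]].
by apply/hasP; exists p; rewrite ?pi.
Qed.

Lemma search_from_startP k n (P : {set {set path_graph n}}) :
    0 < n -> (forall v : path_graph n, ~~ dominating [set v]) ->
    prc_partition P -> #|P| = k ->
  search_from_start k n.
Proof.
move=> n_gt0 nodom prcP /(word_of_prc_partition nodom prcP)[w [sizew]].
case: w sizew n_gt0 => [<- //|c w <- _ /andP[lt_c w_lt]] /=.
case: c lt_c => //= k_gt0 can_w /allP prc_w; apply: searchP => // i lt_i.
have := prc_w i; rewrite mem_iota => /(_ lt_i)/hasP[j]; rewrite mem_iota /=.
move=> lt_j /and4P[neq_ij ndi ndj coal]; exists (i, j); split=> //=.
- rewrite mem_filter neq_ij; apply/allpairsP; exists (i, j).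
  by rewrite !mem_iota.
- by rewrite negb_and ndi orbT.
- by rewrite negb_and ndj orbT.
Qed.

(** * Prefixing copies of 0110 *)

(* Repetitions of 0110 only contribute windows satisfying the conditions of every
   coalition with 0 or 1, so they preserve a coalition graph which is a double
   star with centres 0 and 1. *)
Definition zigzag m w := iter m (fun v => [:: 0; 1; 1; 0] ++ v) w.

Lemma size_zigzag m w : size (zigzag m w) = 4 * m + size w.
Proof. by elim: m => //= m ->; rewrite mulnS. Qed.

Lemma zigzag_cons01 m w :
  exists v, zigzag m [:: 0, 1 & w] = [:: 0, 1 & v].
Proof. by case: m => [|m]; eexists. Qed.

(** The windows centred in the prefix, junctions included: every copy is followed by 0, as the base
    word also starts with 0, 1. *)
Definition zigzag_windows k : seq window :=
  [:: (k, 0, 1); (0, 0, 1); (0, 1, 1); (1, 1, 0); (1, 0, 0)].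

(** Besides [k], the preceding letter 0 is allowed because the induction resumes after a copy ending
    in 0. *)
Lemma windows_zigzag_sub k m w x : x \in [:: k; 0] ->
  {subset windows k x (zigzag m [:: 0, 1 & w])
     <= zigzag_windows k ++ windows k k [:: 0, 1 & w]}.
Proof.
elim: m x => [|m IHm] x x_k0 t /=.
  rewrite !inE => /or3P[/eqP->|->|->]; rewrite ?orbT //.
  by move: x_k0; rewrite !inE => /orP[] /eqP ->; rewrite eqxx ?orbT.
have [v eq_v] := zigzag_cons01 m w.
rewrite eq_v /= -/(windows k 0 [:: 0, 1 & v]) -eq_v !inE.
have {}IHm := IHm 0 _ t; rewrite !inE eqxx orbT in IHm.
case/or4P=> [/eqP->|/eqP->|/eqP->|]; rewrite ?eqxx ?orbT //.
  by move: x_k0; rewrite !inE => /orP[] /eqP ->; rewrite eqxx ?orbT.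
by case/orP=> [/eqP->|/IHm->//]; rewrite eqxx ?orbT.
Qed.

(* The first window of the base word is lost: its left neighbour changes from
   missing to 0. *)
Lemma behead_windows_zigzag k m w x :
  {subset behead (windows k k [:: 0, 1 & w])
     <= windows k x (zigzag m [:: 0, 1 & w])}.
Proof.
elim: m x => [|m IHm] x t /=; first by rewrite !inE => ->; rewrite orbT.
by move/(IHm 0); rewrite !inE => ->; rewrite !orbT.
Qed.

(** A test independent of the number of copies: local conditions on all windows that may occur,
    non-domination on those that always survive. *)
Definition zigzag_coalition k i j W :=
  [&& i != j, ~~ all (dominates_at (pred1 i)) (behead W),
      ~~ all (dominates_at (pred1 j)) (behead W)
    & all (coalition_at i j) (zigzag_windows k ++ W)].

Lemma zigzag_coalitionP k m w i j :
    zigzag_coalition k i j (windows k k [:: 0, 1 & w]) ->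
  word_coalition i j (windows k k (zigzag m [:: 0, 1 & w])).
Proof.
case/and4P=> neq_ij ndi ndj coal; apply/and4P; split=> //.
- apply: contra ndi => /allP domi; apply/allP => t.
  by move/(behead_windows_zigzag m k)/domi.
- apply: contra ndj => /allP domj; apply/allP => t.
  by move/(behead_windows_zigzag m k)/domj.
- move/allP: coal => coal; apply/allP => t.
  by move/(windows_zigzag_sub (mem_head _ _))/coal.
Qed.

Lemma zigzag_prc_partition k n m w :
    n = 4 * m + size [:: 0, 1 & w] -> all (fun c => c < k) [:: 0, 1 & w] ->
    all (mem [:: 0, 1 & w]) (iota 0 k) ->
    all (fun i => has (fun j => zigzag_coalition k i j
           (windows k k [:: 0, 1 & w])) (iota 0 k)) (iota 0 k) ->
  exists2 P : {set {set path_graph n}}, prc_partition P & #|P| = k.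
Proof.
move=> def_n w_lt w_onto /allP coal.
apply: (@prc_partition_of_word _ _ (zigzag m [:: 0, 1 & w])).
- by rewrite size_zigzag.
- have [lt0 lt1] : 0 < k /\ 1 < k by case/and3P: w_lt.
  by elim: m {def_n} => // m IHm; rewrite /= lt0 lt1.
- apply: sub_all w_onto => i /=; elim: m {def_n} => // m IHm /IHm.
  by rewrite /= !inE => ->; rewrite !orbT.
- apply/allP => i /coal /hasP[j j_k coal_ij]; apply/hasP; exists j => //.
  exact: zigzag_coalitionP.
Qed.

(** * Values for paths *)

Lemma card_set_ord_le n (A : {set 'I_n}) (s : seq nat) :
  (forall i, i \in A -> (i : nat) \in s) -> #|A| <= size s.
Proof.
move=> sub; rewrite cardE -(size_map val).
apply: uniq_leq_size; first by rewrite (map_inj_uniq val_inj) enum_uniq.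
by move=> _ /mapP[i iA ->]; apply: sub; rewrite -mem_enum.
Qed.

Lemma card_closed_nbhd_path n (v : path_graph n) : #|closed_nbhd v| <= 3.
Proof.
apply: (@card_set_ord_le n _ [:: (v : 'I_n).-1; (v : 'I_n) : nat; (v : 'I_n).+1]).
move=> u; rewrite !inE /= /path_adj => /or3P[/eqP->|/eqP->|/eqP<-];
  by rewrite /= eqxx ?orbT.
Qed.

Lemma card_closed_nbhd_path0 n :
  #|closed_nbhd (ord0 : path_graph n.+1)| <= 2.
Proof.
apply: (@card_set_ord_le n.+1 _ [:: 0; 1]).
by move=> u; rewrite !inE /= /path_adj => /or3P[/eqP->|/eqP<-|].
Qed.

Lemma path_not_dominating1 n (v : path_graph n) : 3 < n -> ~~ dominating [set v].
Proof.
move=> n_gt3; apply/negP => /dominatingP domv.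
suff nbT : closed_nbhd v = setT.
  have := card_closed_nbhd_path v; rewrite nbT cardsT card_ord.
  by rewrite leqNgt n_gt3.
apply/setP => u; have [w] := domv u; rewrite inE => /eqP ->.
by rewrite !inE adj_sym eq_sym.
Qed.

(** The bound 6 leaves only the sizes from [k.+1] to 6 to be excluded by search; for [k = 6] there
    are none. *)
Lemma PRC_path_small n k :
    3 < n -> all (fun i => ~~ search_from_start i n) (iota k.+1 (6 - k)) ->
    (exists2 P : {set {set path_graph n}}, prc_partition P & #|P| = k) ->
  PRC (path_graph n) = k.
Proof.
case: n => // n n_gt3 /allP no_word; apply: PRC_eq => P prcP.
have nodom v := path_not_dominating1 v n_gt3.
have le6 : #|P| <= 6.
  apply: (prc_partition_le6 (v := ord0 : path_graph n.+1) _ _ nodom prcP).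
    exact: card_closed_nbhd_path.
  exact: card_closed_nbhd_path0.
rewrite leqNgt; apply/negP => gt_k.
have := search_from_startP (ltn0Sn n) nodom prcP erefl; apply/negP/no_word.
by rewrite mem_iota gt_k addSn ltnS subnKC // (leq_trans (ltnW gt_k)).
Qed.

Theorem theorem3p3 (n : nat) (hn : 1 <= n) :
  PRC (path_graph n) =
    if n == 1 then 1
    else if n == 2 then 2
    else if n == 3 then 0
    else if n \in [:: 4; 6; 8] then 4
    else if n == 5 then 3
    else if n \in [:: 7; 9; 10; 11; 13] then 5
    else 6.
Proof.
have word m k w : size w = m -> 3 < m -> 
    [&& all (fun c => c < k) w, all (mem w) (iota 0 k),
        word_prc k (windows k k w)
      & all (fun i => ~~ search_from_start i m) (iota k.+1 (6 - k))] ->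
    PRC (path_graph m) = k.
  move=> size_w m_gt3 /and4P[w_lt w_onto prc_w no_word].
  apply: (PRC_path_small m_gt3 no_word).
  exact: prc_partition_of_word size_w w_lt w_onto prc_w.
have zig m w : 3 < n -> n = 4 * m + size [:: 0, 1 & w] ->
    [&& all (fun c => c < 6) [:: 0, 1 & w],
        all (mem [:: 0, 1 & w]) (iota 0 6)
      & all (fun i => has (fun j => zigzag_coalition 6 i j
               (windows 6 6 [:: 0, 1 & w])) (iota 0 6)) (iota 0 6)] ->
    PRC (path_graph n) = 6.
  move=> n_gt3 def_n /and3P[w_lt w_onto coal].
  apply: (PRC_path_small n_gt3) => //.
  exact: zigzag_prc_partition def_n w_lt w_onto coal.
have [n_big|n_small] := boolP ((n == 12) || (13 < n)).
  have -> : (if n == 1 then 1 else if n == 2 then 2 else if n == 3 then 0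
     else if n \in [:: 4; 6; 8] then 4 else if n == 5 then 3
     else if n \in [:: 7; 9; 10; 11; 13] then 5 else 6) = 6.
    rewrite !inE; by do 12!(case: eqP => [?|_]; first by lia).
  have [m [] def_n] : exists m, [\/ n = 4 * m + 12, n = 4 * m + 14,
      n = 4 * m + 15 | n = 4 * m + 17].
    (* There is one base length per residue modulo 4. Residue 1 starts at 17, since 13 has value 5,
       hence one copy fewer. *)
    exists ((n - 12) %/ 4 - (n %% 4 == 1)).
    have : n %% 4 < 4 by rewrite ltn_mod.
    case E: (n %% 4) => [|[|[|[|]]]] // _;
    [constructor 1|constructor 4|constructor 2|constructor 3] => /=; lia.
  (* In each base word, 0 and 1 have two partners each among the colours 2 to 5, the extremal case
     of the bound. *)
  - apply: (zig m [:: 2; 0; 3; 1; 0; 4; 1; 5; 0; 1]) => //; lia.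
  - apply: (zig m [:: 1; 0; 2; 1; 3; 0; 1; 4; 0; 5; 1; 0]) => //; lia.
  - apply: (zig m [:: 2; 0; 3; 1; 0; 4; 1; 5; 4; 1; 5; 0; 1]) => //; lia.
  - apply: (zig m [:: 1; 0; 2; 1; 3; 0; 1; 4; 0; 5; 4; 0; 5; 1; 0]) => //; lia.
have : n \in iota 1 13 by rewrite mem_iota; lia.
rewrite !inE.
have dom3 : @dominating (path_graph 3) [set (inord 1 : 'I_3)].
  apply/dominatingP => v; exists (inord 1); rewrite ?set11 // !inE /= /path_adj.
  by rewrite -val_eqE /= !inordK //; case: v => [[|[|[|]]]].
do 12?case/orP; move/eqP=> def_n; rewrite def_n //= in n_small *.
- by rewrite PRC_complete ?card_ord // => -[[|u] u1] [[|v] v1].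
- by rewrite PRC_complete ?card_ord // => -[[|[|u]] u2] [[|[|v]] v2].
- by apply: (@PRC_universal_vertex (path_graph 3) _ ord0 ord_max dom3).
(* Each word gives the lower bound, and the computed searches give the upper one. The words of
   lengths 8, 11 and 13 are those of lengths 4, 7 and 9 prefixed by 0110. *)
- by apply: (word _ _ [:: 0; 1; 2; 3]) => //; vm_compute.
- by apply: (word _ _ [:: 0; 0; 1; 1; 2]) => //; vm_compute.
- by apply: (word _ _ [:: 0; 1; 1; 0; 2; 3]) => //; vm_compute.
- by apply: (word _ _ [:: 0; 1; 2; 0; 3; 1; 4]) => //; vm_compute.
- by apply: (word _ _ [:: 0; 1; 1; 0; 0; 1; 2; 3]) => //; vm_compute.
- by apply: (word _ _ [:: 0; 1; 1; 0; 2; 1; 3; 0; 4]) => //; vm_compute.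
- by apply: (word _ _ [:: 0; 1; 2; 0; 3; 2; 0; 3; 1; 4]) => //; vm_compute.
- by apply: (word _ _ [:: 0; 1; 1; 0; 0; 1; 2; 0; 3; 1; 4]) => //; vm_compute.
- by apply: (word _ _ [:: 0; 1; 1; 0; 0; 1; 1; 0; 2; 1; 3; 0; 4]) => //; vm_compute.
Qed.
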